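(* Let $f$ be $\rho$-weakly convex and $r$ be $\eta$-weakly convex on $\mathbb{X}$, and let $0<\lambda<\frac{1}{\rho+2\eta}$. Let $\{x^k\}_{k\in\mathbb{N}}$ be generated by Prox-SubGrad for $\min_{x\in\mathbb{X}}\varphi(x)=f(x)+r(x)$, and let $\{\beta_k\}$ be a $\sigma$-sequence, meaning $\beta_k>0$, $\sum_k\beta_k=\infty$ and $\sum_k\beta_k^2<\infty$. Then, under each of the conditions (B$_{\text{D-D}}$), (B$_1$) and (B$_3$), with the stepsizes – $\alpha_k=\beta_k<\frac{1}{2(\frac1\lambda+2\eta+\rho)}$ in case (B$_{\text{D-D}}$), – $\alpha_k=\frac{\beta_k}{\|g(x^k)\|+L_r}$ in case (B$_1$), – $\alpha_k=\beta_k<\frac{1}{6\eta}$ in case (B$_3$), one uniformly has the recursion, with some $\gamma_1,\gamma_2\ge0$, $$[\varphi_\lambda(x^{k+1})-\varphi^*]-(1+\gamma_1\beta_k^2)[\varphi_\lambda(x^k)-\varphi^*]\le-\frac{(1-\lambda(\rho+2\eta))\alpha_k}{2}\|\nabla\varphi_\lambda(x^k)\|^2+\gamma_2\beta_k^2.$$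
   Context: Setting: $\mathbb{X}\subseteq\mathbb{R}^d$ is closed and convex; $f,r:\mathbb{X}\to\mathbb{R}$ are proper and lower semicontinuous; $\varphi=f+r$; the set $\mathbb{X}^*$ of minimizers of $\varphi$ over $\mathbb{X}$ is non-empty and $\varphi^*$ is the minimum value. A function $u:\mathbb{X}\to\mathbb{R}$ is $\rho$-weakly convex if $\theta=u+\frac{\rho}{2}\|\cdot\|^2$ is convex; then $\partial u(x)=\partial\theta(x)-\rho x$, where $\partial\theta(x)=\{v:\theta(y)\ge\theta(x)+\langle v,y-x\rangle\ \forall y\in\mathbb{X}\}$. Moreau envelope: $\varphi_\lambda(x)=\min_{y\in\mathbb{X}}\{\varphi(y)+\frac{1}{2\lambda}\|y-x\|^2\}$, with unique minimizer $\mathrm{Prox}_{\lambda,\varphi}(x)$, and $\nabla\varphi_\lambda(x)=\frac1\lambda(x-\mathrm{Prox}_{\lambda,\varphi}(x))$. Prox-SubGrad: starting from $x^0\in\mathbb{X}$, for $k=0,1,\dots$ pick $g(x^k)\in\partial f(x^k)$ and a step size $\alpha_k$, and set $x^{k+1}=\arg\min_{x\in\mathbb{X}}\langle g(x^k),x\rangle+r(x)+\frac{1}{2\alpha_k}\|x-x^k\|^2$. Conditions (for all $x\in\mathbb{X}$, $g(x)\in\partial f(x)$, $h(x)\in\partial r(x)$): (B$_{\text{D-D}}$) $\|g(x)\|\le L_f$ for a constant $L_f$; (B$_1$) $\|h(x)\|\le L_r$ for a constant $L_r$; (B$_3$) $\|g(x)+h(x)\|\le\sqrt{c_3[\varphi_\lambda(x)-\varphi^*]+c_4}$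 for some $c_3,c_4\ge0$. Convention: $1/(6\eta)=+\infty$ if $\eta=0$ (and $\frac{1}{\rho+2\eta}=+\infty$ if $\rho=\eta=0$). *)

(* Defs.v *)
From HB Require Import structures.
From mathcomp Require Import all_boot all_order all_algebra.
From mathcomp Require Import all_classical all_reals all_analysis.

Set Implicit Arguments.
Unset Strict Implicit.
Unset Printing Implicit Defensive.

Import Order.TTheory GRing.Theory Num.Theory.
Import numFieldNormedType.Exports.

Local Open Scope classical_set_scope.
Local Open Scope ring_scope.

(* The library norm `|x| on 'rV[R]_d is the sup norm, hence a separate
   Euclidean inner product and norm. *)
Definition dotv (R : realType) (d : nat) (u v : 'rV[R]_d) : R :=
  \sum_(i < d) u 0 i * v 0 i.

Definition enorm (R : realType) (d : nat) (u : 'rV[R]_d) : R :=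
  Num.sqrt (dotv u u).

(* A real-valued function on X is represented by a total function on 'rV[R]_d;
   every notion below only looks at its values on X. *)

(* In the topology of [subspace X], points outside X are isolated, so the
   condition is void there. *)
Definition lsc_on (R : realType) (d : nat) (X : set 'rV[R]_d)
    (u : 'rV[R]_d -> R) : Prop :=
  lower_semicontinuous (fun x : subspace X => (u x)%:E).

Definition quad_shift (R : realType) (d : nat) (rho : R) (u : 'rV[R]_d -> R)
    (x : 'rV[R]_d) : R :=
  u x + rho / 2 * enorm x ^+ 2.

Definition weakly_convex (R : realType) (d : nat) (X : set 'rV[R]_d) (rho : R)
    (u : 'rV[R]_d -> R) : Prop :=
  convex_function X (quad_shift rho u).

Definition convex_subdiff (R : realType) (d : nat) (X : set 'rV[R]_d)
    (theta : 'rV[R]_d -> R) (x : 'rV[R]_d) : set 'rV[R]_d :=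
  [set v | forall y, X y -> theta x + dotv v (y - x) <= theta y].

Definition subdiff (R : realType) (d : nat) (X : set 'rV[R]_d) (rho : R)
    (u : 'rV[R]_d -> R) (x : 'rV[R]_d) : set 'rV[R]_d :=
  [set v - rho *: x | v in convex_subdiff X (quad_shift rho u) x].

Definition argmin_on (R : realType) (d : nat) (X : set 'rV[R]_d)
    (u : 'rV[R]_d -> R) : set 'rV[R]_d :=
  [set x | X x /\ forall y, X y -> u x <= u y].

(* The minimum value whenever [argmin_on X u] is non-empty. *)
Definition minval (R : realType) (d : nat) (X : set 'rV[R]_d)
    (u : 'rV[R]_d -> R) : R :=
  inf (u @` X).

(* Defined at every point of the ambient space, so that its gradient makes
   sense at boundary points of X. *)
Definition moreau_env (R : realType) (d : nat) (X : set 'rV[R]_d)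
    (lambda : R) (u : 'rV[R]_d -> R) (x : 'rV[R]_d) : R :=
  minval X (fun y => u y + (2 * lambda)^-1 * enorm (y - x) ^+ 2).

Definition gradient (R : realType) (d : nat) (u : 'rV[R]_d -> R)
    (x : 'rV[R]_d) : 'rV[R]_d :=
  \row_(i < d) 'D_(delta_mx 0 i) u x.

(* [g k] is the subgradient picked at the iterate [x k]. *)
Definition prox_subgrad (R : realType) (d : nat) (X : set 'rV[R]_d) (rho : R)
    (f r : 'rV[R]_d -> R) (alpha : nat -> R) (g x : nat -> 'rV[R]_d) : Prop :=
  X (x 0%N) /\
  forall k : nat,
    [/\ 0 < alpha k,
        subdiff X rho f (x k) (g k) &
        argmin_on X (fun y => dotv (g k) y + r y
                              + (2 * alpha k)^-1 * enorm (y - x k) ^+ 2)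
                  (x k.+1)].

Definition sigma_sequence (R : realType) (beta : nat -> R) : Prop :=
  [/\ forall k, 0 < beta k,
      series beta n @[n --> \oo] --> +oo &
      cvgn (series (fun k => beta k ^+ 2))].

Definition bounded_subgrad (R : realType) (d : nat) (X : set 'rV[R]_d)
    (rho : R) (u : 'rV[R]_d -> R) (L : R) : Prop :=
  forall x g, X x -> subdiff X rho u x g -> enorm g <= L.

Definition env_bounded_subgrad (R : realType) (d : nat) (X : set 'rV[R]_d)
    (rho eta lambda : R) (f r : 'rV[R]_d -> R) (c3 c4 : R) : Prop :=
  forall x g h, X x -> subdiff X rho f x g -> subdiff X eta r x h ->
    enorm (g + h) <=
      Num.sqrt (c3 * (moreau_env X lambda (f \+ r) x - minval X (f \+ r)) + c4).

(* Main.v *)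
Require Import Defs.
From HB Require Import structures.
From mathcomp Require Import all_boot all_order all_algebra.
From mathcomp Require Import all_classical all_reals all_analysis.
From mathcomp Require Import ring lra.
Set Implicit Arguments.
Unset Strict Implicit.
Import Order.TTheory GRing.Theory Num.Theory.
Import numFieldNormedType.Exports.
Local Open Scope classical_set_scope.
Local Open Scope ring_scope.

(* Let xh be the proximal point of phi at x = x^k, P = |xh - x|^2 and
   Q = |xh - x^{k+1}|^2. Testing the infimum phi_lambda(x^{k+1}) at xh gives
   phi_lambda(x^{k+1}) - phi_lambda(x) <= (Q - P) / (2 lambda), while
   grad phi_lambda(x) = (x - xh) / lambda. So it suffices to prove
   Q <= (1 - alpha_k D) P + O(beta_k^2) with D = 1/lambda - rho - 2 eta. This
   combines the growth of the step objective away from its minimizer x^{k+1},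
   the growth of the proximal objective away from xh, and the subgradient
   inequality for f at x; each of the three conditions controls the remaining
   first-order term |x^{k+1} - x|.
   Under (B_1) the stepsize need not be small compared with 1/eta; large steps
   are handled by expanding Q directly, since |x^{k+1} - x| <= beta_k always
   holds there. *)

(** * Euclidean inner product and norm on row vectors *)

Section euclidean.
Context {R : realType} {d : nat}.
Implicit Types (u v w : 'rV[R]_d) (a : R).

Lemma dotvC u v : dotv u v = dotv v u.
Proof. by apply: eq_bigr => i _; rewrite mulrC. Qed.

Lemma dotvDl u v w : dotv (u + v) w = dotv u w + dotv v w.
Proof. by rewrite /dotv -big_split; apply: eq_bigr => i _; rewrite mxE mulrDl. Qed.

Lemma dotvZl a u v : dotv (a *: u) v = a * dotv u v.
Proof. by rewrite /dotv mulr_sumr; apply: eq_bigr => i _; rewrite mxE mulrA. Qed.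

Lemma dotvNl u v : dotv (- u) v = - dotv u v.
Proof. by rewrite -scaleN1r dotvZl mulN1r. Qed.

Lemma dotvDr u v w : dotv w (u + v) = dotv w u + dotv w v.
Proof. by rewrite dotvC dotvDl !(dotvC _ w). Qed.

Lemma dotvZr a u v : dotv u (a *: v) = a * dotv u v.
Proof. by rewrite dotvC dotvZl dotvC. Qed.

Lemma dotvNr u v : dotv u (- v) = - dotv u v.
Proof. by rewrite dotvC dotvNl dotvC. Qed.

Definition dotvE := (dotvDl, dotvDr, dotvNl, dotvNr, dotvZl, dotvZr).

Lemma dotvv_ge0 u : 0 <= dotv u u.
Proof. by apply: sumr_ge0 => i _; rewrite -expr2 sqr_ge0. Qed.

Lemma enorm_ge0 u : 0 <= enorm u.
Proof. exact: sqrtr_ge0. Qed.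

Lemma sqr_enorm u : enorm u ^+ 2 = dotv u u.
Proof. by rewrite sqr_sqrtr// dotvv_ge0. Qed.

(** Balls and compact sets come from the sup norm; this comparison carries Euclidean bounds over to
    that topology. *)
Lemma norm_le_enorm u : `|u| <= enorm u.
Proof.
rewrite [leLHS]/Num.norm /= mx_normrE; apply/bigmax_leP; split => [|[i j] _ /=].
  exact: enorm_ge0.
rewrite -(@ler_pXn2r _ 2)// ?nnegrE ?enorm_ge0// sqr_enorm -normrX ger0_norm ?sqr_ge0//.
rewrite ord1 /dotv (bigD1 j)//= -expr2 lerDl sumr_ge0// => k _.
by rewrite -expr2 sqr_ge0.
Qed.

Lemma dotv_le_enorm u v : dotv u v <= enorm u * enorm v.
Proof.
have [/eqP u0|u0] := boolP (enorm u == 0).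
  suff -> : u = 0 by rewrite -(scale0r (0 : 'rV[R]_d)) dotvZl mul0r mulr_ge0 ?enorm_ge0.
  by apply/eqP; rewrite -normr_le0 -u0 norm_le_enorm.
have [/eqP v0|v0] := boolP (enorm v == 0).
  suff -> : v = 0 by rewrite -(scale0r (0 : 'rV[R]_d)) dotvZr mul0r mulr_ge0 ?enorm_ge0.
  by apply/eqP; rewrite -normr_le0 -v0 norm_le_enorm.
have ugt0 : 0 < enorm u by rewrite lt_neqAle eq_sym u0 enorm_ge0.
have vgt0 : 0 < enorm v by rewrite lt_neqAle eq_sym v0 enorm_ge0.
(* Cauchy-Schwarz: this square expands to twice [enorm u * enorm v] times the gap between the two
   sides. *)
have := dotvv_ge0 (enorm v *: u - enorm u *: v).
rewrite !dotvE (dotvC v u) -!sqr_enorm => h.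
rewrite -(ler_pM2l (mulr_gt0 ugt0 vgt0)); nra.
Qed.

Lemma enormN u : enorm (- u) = enorm u.
Proof. by rewrite /enorm !dotvE opprK. Qed.

Lemma enormB u v : enorm (u - v) = enorm (v - u).
Proof. by rewrite -opprB enormN. Qed.

Lemma enormZ a u : 0 <= a -> enorm (a *: u) = a * enorm u.
Proof.
by move=> a0; rewrite /enorm !dotvE mulrA -expr2 sqrtrM ?sqr_ge0// sqrtr_sqr ger0_norm.
Qed.

Lemma sqr_enormD u v :
  enorm (u + v) ^+ 2 = enorm u ^+ 2 + 2 * dotv u v + enorm v ^+ 2.
Proof. by rewrite !sqr_enorm !dotvE (dotvC v u); ring. Qed.

Lemma enormD u v : enorm (u + v) <= enorm u + enorm v.
Proof.
rewrite -(@ler_pXn2r _ 2)// ?nnegrE ?addr_ge0 ?enorm_ge0//.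
rewrite sqr_enormD sqrrD.
by have := dotv_le_enorm u v; lra.
Qed.

Lemma continuous_sqr_enorm v : continuous (fun u => enorm (u - v) ^+ 2).
Proof.
under eq_fun do rewrite sqr_enorm /dotv.
apply: continuous_big => [|i _ u]; first exact: add_continuous.
have h : (w - v) 0 i @[w --> u] --> (u - v) 0 i.
  under eq_fun do rewrite !mxE; rewrite !mxE.
  apply: cvgB; [exact: (nbhs_filter u)|exact: coord_continuous|].
  by apply: cvg_cst; exact: (nbhs_filter u).
by apply: cvgM; first exact: (nbhs_filter u).
Qed.

End euclidean.

(** * Lower semicontinuity on [X] and existence of minimizers *)

Section lower_semicontinuity.
Context {R : realType} {d : nat}.
Implicit Types (X : set 'rV[R]_d) (u v : 'rV[R]_d -> R).

Lemma lsc_onP X u : lsc_on X u <->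
  forall x a, X x -> a < u x -> \forall y \near x, X y -> a < u y.
Proof.
split=> [ulsc x a Xx aux|ulsc x a].
  have [|V] := ulsc x a; first by rewrite lte_fin.
  case: (@nbhs_subspaceP _ X x) => [_ VX Vu|/(_ Xx)//].
  by apply: filterS VX => y /Vu; rewrite lte_fin.
rewrite lte_fin => aux.
exists [set y | a < u y]; last by move=> y; rewrite lte_fin.
case: (@nbhs_subspaceP _ X x) => Xx; first exact: ulsc.
by move=> y ->.
Qed.

Lemma lsc_onD X u v : lsc_on X u -> lsc_on X v -> lsc_on X (u \+ v).
Proof.
move=> /lsc_onP ulsc /lsc_onP vlsc; apply/lsc_onP => x a Xx /= auv.
pose e := (u x + v x - a) / 2.
have e0 : 0 < e by rewrite /e; lra.
have := ulsc x (u x - e) Xx; have := vlsc x (v x - e) Xx.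
move=> /(_ ltac:(lra)) vx /(_ ltac:(lra)) ux.
near=> y => Xy.
have vy : v x - e < v y by apply: (near vx y).
have uy : u x - e < u y by apply: (near ux y).
by rewrite /e in vy uy; lra.
Unshelve. all: by end_near. Qed.

Lemma lsc_on_continuous X u : continuous u -> lsc_on X u.
Proof.
move=> ucts; apply/lsc_onP => x a Xx aux.
have := @cvgr_gt _ _ _ (nbhs_filter x) _ _ (ucts x) a aux.
by apply: (@filterS _ _ (nbhs_filter x)) => y ay _.
Qed.

(** The sublevel sets [sub c] generate a proper filter that meets the compact [K], so it clusters at
    some [p]. If [u c < u p], lower semicontinuity gives a neighbourhood of [p] that misses [sub c],
    contradicting clustering. *)
Lemma lsc_argmin X u x0 M : closed X -> lsc_on X u -> X x0 ->
  (forall y, X y -> u y <= u x0 -> enorm y <= M) -> argmin_on X u !=set0.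
Proof.
move=> Xcl /lsc_onP ulsc Xx0 ucoer.
pose K := X `&` [set y | `|y| <= M].
have Kcpt : compact K.
  apply: bounded_closed_compact.
    by exists M; split; [exact: num_real|move=> N MN y [_ /= yM]; lra].
  apply: closedI => //.
  have Mcl := @closed_le R M.
  have := @preimage_closed 'rV[R]_d R (fun y => `|y|) [set t | t <= M] _ Mcl.
  apply => y _.
  exact: norm_continuous.
pose sub c := [set y | X y /\ u y <= u c].
have Ffilter : ProperFilter (filter_from X sub).
  apply: filter_from_proper; last by move=> c Xc; exists c; split.
  apply: filter_from_filter; first by exists x0.
  move=> b c Xb Xc; have [bc|/ltW cb] := leP (u b) (u c).
    by exists b => // y [Xy yb]; split; split=> //; exact: le_trans bc.
  by exists c => // y [Xy yc]; split; split=> //; exact: le_trans cb.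
have [|p [[Xp _] pcluster]] := Kcpt _ Ffilter.
  exists x0 => // y [Xy yx0]; split => //=.
  exact: le_trans (norm_le_enorm _) (ucoer _ Xy yx0).
exists p; split=> // c Xc; rewrite leNgt; apply/negP => /(ulsc _ _ Xp) near_p.
have /(_ _) [|y [[Xy yc]]] := pcluster (sub c) _ _ near_p; first by exists c.
by move=> /(_ Xy); rewrite ltNge yc.
Qed.

End lower_semicontinuity.

(** * Convexity with a quadratic modulus and growth away from a minimizer *)

Section strong_convexity.
Context {R : realType} {d : nat}.
Implicit Types (X : set 'rV[R]_d) (u v : 'rV[R]_d -> R) (m : R).

(* The modulus [m] may have any sign: [m < 0] is [(- m)]-weak convexity. *)
Definition strongly_convex X m u := forall x y t, X x -> X y -> 0 <= t <= 1 ->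
  X (x + t *: (y - x)) /\
  u (x + t *: (y - x)) <=
    (1 - t) * u x + t * u y - m / 2 * (t * (1 - t)) * enorm (y - x) ^+ 2.

Lemma weakly_strongly_convex X m u : convex_set X -> weakly_convex X m u ->
  strongly_convex X (- m) u.
Proof.
move=> Xcvx uwc x y t /mem_set Xx /mem_set Xy t01.
have [t0 t1] := andP t01.
pose i := Itv01 t0 t1.
(* [conv] gives the weight [t] to its first argument, hence the order [y], [x]. *)
have convE : (conv i (y : convex_lmodType 'rV[R]_d) x) = x + t *: (y - x).
  rewrite /conv /= /unstable.onem scalerBl scale1r scalerBr.
  by rewrite addrC -addrA (addrC (- _)).
split; first by rewrite -convE; apply/set_mem/Xcvx.
have := uwc i y x Xy Xx.
rewrite convE /quad_shift convRE /= /unstable.onem !sqr_enorm !dotvE (dotvC y x).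
lra.
Qed.

Lemma strongly_convexD X m n u v : strongly_convex X m u ->
  strongly_convex X n v -> strongly_convex X (m + n) (u \+ v).
Proof.
move=> ucvx vcvx x y t Xx Xy t01.
have [Xt ut] := ucvx x y t Xx Xy t01; have [_ vt] := vcvx x y t Xx Xy t01.
split=> //=; lra.
Qed.

Lemma strongly_convex_quad X c z : convex_set X ->
  strongly_convex X (2 * c) (fun y => c * enorm (y - z) ^+ 2).
Proof.
move=> Xcvx x y t Xx Xy t01; split.
  have [] // := @weakly_strongly_convex X 0 (cst 0) Xcvx _ x y t Xx Xy t01.
  move=> i a b _ _.
  by rewrite convRE /quad_shift /cst /=; lra.
rewrite !sqr_enorm !dotvE (dotvC y x) (dotvC z x) (dotvC z y); lra.
Qed.

Lemma strongly_convex_linear X g : convex_set X ->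
  strongly_convex X 0 (dotv g).
Proof.
move=> Xcvx x y t Xx Xy t01; split.
  by have [] := @strongly_convex_quad X 0 0 Xcvx x y t Xx Xy t01.
by rewrite !dotvE; lra.
Qed.

(** Compare [u z] with the value at [z + t (y - z)], divide by [t], and let [t] tend to 0. *)
Lemma strongly_convex_growth X m u z y : strongly_convex X m u ->
  argmin_on X u z -> X y -> u z + m / 2 * enorm (y - z) ^+ 2 <= u y.
Proof.
move=> ucvx [Xz zmin] Xy; set N := _ ^+ 2.
have key t : 0 < t -> t <= 1 -> u z + m / 2 * (1 - t) * N <= u y.
  move=> t0 t1.
  have [|Xt ut] := ucvx z y t Xz Xy; first by rewrite (ltW t0).
  have := zmin _ Xt; rewrite -/N in ut => zt.
  by rewrite -(ler_pM2l t0); nra.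
apply/ler_addgt0Pr => e e0.
pose B := `|m / 2 * N|.
have B0 : 0 <= B by exact: normr_ge0.
(* The value [t = e / (B + e)] lies in []0, 1]] and makes the error [t * B] at most [e]. *)
have t0 : 0 < e / (B + e) by rewrite divr_gt0//; lra.
have t1 : e / (B + e) <= 1 by rewrite ler_pdivrMr; lra.
have := key _ t0 t1.
suff : m / 2 * N * (e / (B + e)) <= e by lra.
apply: le_trans (_ : B * (e / (B + e)) <= _).
  by rewrite ler_pM2r// ler_norm.
rewrite mulrCA -[leRHS]mulr1 ler_pM2l// ler_pdivrMr; lra.
Qed.

End strong_convexity.

(** * Subgradients of weakly convex functions *)

Section weak_subgradient.
Context {R : realType} {d : nat}.
Implicit Types (X : set 'rV[R]_d) (u v : 'rV[R]_d -> R) (m : R).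

Lemma subdiffP X m u x g : subdiff X m u x g <-> forall y, X y ->
  u x + dotv g (y - x) - m / 2 * enorm (y - x) ^+ 2 <= u y.
Proof.
split=> [[w wsub <-] y Xy|gsub].
  have := wsub y Xy.
  by rewrite /quad_shift !sqr_enorm !dotvE (dotvC y x); lra.
exists (g + m *: x); last by rewrite addrK.
move=> y Xy; have := gsub y Xy.
by rewrite /quad_shift !sqr_enorm !dotvE (dotvC y x); lra.
Qed.

(** First-order optimality without subdifferential calculus: the step objective grows with modulus
    [a^-1 - m] away from [z]. Expanding the squares around [z] cancels the [a^-1] part, which leaves
    the subgradient inequality of [u]. *)
Lemma prox_step_subdiff X m u g x z a : convex_set X -> weakly_convex X m u ->
  0 < a ->
  argmin_on X (fun y => dotv g y + u y + (2 * a)^-1 * enorm (y - x) ^+ 2) z ->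
  subdiff X m u z (- (g + a^-1 *: (z - x))).
Proof.
move=> Xcvx uwc a0 zmin; apply/subdiffP => y Xy.
have := strongly_convex_growth (strongly_convexD (strongly_convexD
  (strongly_convex_linear g Xcvx) (weakly_strongly_convex Xcvx uwc))
  (strongly_convex_quad (2 * a)^-1 x Xcvx)) zmin Xy.
rewrite /= invfM !sqr_enorm !dotvE.
rewrite (dotvC y x) (dotvC z x) (dotvC y z).
lra.
Qed.

End weak_subgradient.

(** * Proximal points, the Moreau envelope and its gradient *)

Section prox.
Context {R : realType} {d : nat}.
Implicit Types (X : set 'rV[R]_d) (u : 'rV[R]_d -> R) (m l : R).

Lemma coercive_argmin X u z x0 b q e : closed X -> lsc_on X u -> X x0 ->
  0 <= q -> 0 < e ->
  (forall y, X y -> b - q * enorm (y - z) + e * enorm (y - z) ^+ 2 <= u y) ->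
  argmin_on X u !=set0.
Proof.
move=> Xcl ulsc Xx0 q0 e0 ulb.
(* Beyond distance [B] from [z] the quadratic term outweighs [q] times the distance plus [u x0 - b],
   so [u] exceeds [u x0]. *)
pose B := 1 + (q + `|u x0 - b|) / e.
apply: (@lsc_argmin _ _ X u x0 (B + enorm z)) => // y Xy yx0.
rewrite -[y in enorm y](subrK z) (le_trans (enormD _ _))// lerD2r.
have K0 := normr_ge0 (u x0 - b); have := ler_norm (u x0 - b).
have := ulb y Xy; have := enorm_ge0 (y - z).
move: (enorm _) => N N0 lb uxb.
rewrite leNgt; apply/negP => BN.
have eN : q + `|u x0 - b| < e * (N - 1).
  by rewrite mulrC -ltr_pdivrMr// /B in BN *; lra.
have N1 : 1 < N.
  apply: le_lt_trans BN; rewrite lerDl divr_ge0//; lra.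
by nra.
Qed.

Lemma lsc_on_add_quad X u c z :
  lsc_on X u -> lsc_on X (fun y => u y + c * enorm (y - z) ^+ 2).
Proof.
move=> ulsc; apply: (@lsc_onD _ _ X u (fun y => c * enorm (y - z) ^+ 2)) => //.
apply: lsc_on_continuous => y.
by apply: cvgMr; [exact: (nbhs_filter y)|exact: continuous_sqr_enorm].
Qed.

(** Neither [y] nor [z] need carry a subgradient, so [z] is replaced by a proximal point [p] with
    large parameter [T]. The subgradient [T (z - p)] at [p] has norm at most [L], hence [p] is close
    to [z]. Lower semicontinuity bounds [u p] below, and the subgradient inequality at [p] is tested
    at [y]. *)
Lemma bounded_subgrad_weak_lipschitz X m u L x0 g0 :
  closed X -> convex_set X -> lsc_on X u -> 0 <= m -> weakly_convex X m u ->
  X x0 -> subdiff X m u x0 g0 -> bounded_subgrad X m u L ->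
  forall y z, X y -> X z ->
    u z <= u y + L * enorm (y - z) + m / 2 * enorm (y - z) ^+ 2.
Proof.
move=> Xcl Xcvx ulsc m0 uwc Xx0 g0sub uL y z Xy Xz.
have L0 : 0 <= L by apply: le_trans (uL _ _ Xx0 g0sub); exact: enorm_ge0.
apply/ler_addgt0Pr => e e0.
have /lsc_onP /(_ z (u z - e / 2) Xz) := ulsc.
move=> /(_ ltac:(lra)) /nbhs_ballP[dl /= dl0 zdl].
have := enorm_ge0 (y - z); set S := enorm (y - z) => S0.
pose c := L + m * S + m.
have c0 : 0 <= c by rewrite !addr_ge0// mulr_ge0.
(* With [w] the distance from [z] to [p], [T * w <= L] holds. The summands of [T] ensure in turn
   [T > m] (coercivity), [w < dl], [w <= 1] and [w * c <= e / 2], where [w * c] dominates the error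
   of replacing [z] by [p]. *)
pose T := 1 + m + L / dl + L + 2 * L * c / e.
have Ldl0 : 0 <= L / dl by rewrite divr_ge0// ltW.
have Lce0 : 0 <= 2 * L * c / e by rewrite divr_ge0 ?(ltW e0)// !mulr_ge0.
have [p pmin] : argmin_on X (fun y => u y + T / 2 * enorm (y - z) ^+ 2) !=set0.
  apply: (@coercive_argmin _ _ z x0 (u x0 + dotv g0 (z - x0) - m / 2 * enorm (z - x0) ^+ 2)
    (enorm g0 + m * enorm (z - x0)) ((T - m) / 2)) => //.
  - exact: lsc_on_add_quad.
  - by rewrite addr_ge0 ?mulr_ge0 ?enorm_ge0.
  - rewrite /T; lra.
  (* The known subgradient at [x0] gives a quadratic minorant of [u], recentred here at [z]. *)
  move=> w Xw; have /subdiffP/(_ w Xw) := g0sub.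
  have := dotv_le_enorm (- g0) (w - z); rewrite enormN.
  have := dotv_le_enorm (w - z) (z - x0).
  have -> : w - x0 = (w - z) + (z - x0) by rewrite addrA subrK.
  rewrite sqr_enormD (dotvDr (w - z)) dotvNl => h1 h2 h3.
  have := ler_wpM2l m0 h1; lra.
have Xp := pmin.1.
have psub : subdiff X m u p (T *: (z - p)).
  have T0 : 0 < T^-1 by rewrite invr_gt0 /T; lra.
  have := @prox_step_subdiff _ _ X m u 0 z p T^-1 Xcvx uwc T0.
  rewrite invrK add0r -scalerN opprB; apply.
  rewrite invfM invrK (mulrC _ T).
  under eq_fun do rewrite -(scale0r (0 : 'rV[R]_d)) dotvZl mul0r add0r.
  exact: pmin.
have T1 : 0 < T by rewrite /T; lra.
have Tw : T * enorm (z - p) <= L by rewrite -enormZ ?(ltW T1)//; exact: uL Xp psub.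
have := enorm_ge0 (z - p); move: Tw; set w := enorm (z - p) => Tw w0.
have wdl : w < dl.
  rewrite -(ltr_pM2l T1) (le_lt_trans Tw)// -ltr_pdivrMr// /T; lra.
have w1 : w <= 1.
  by rewrite -(ler_pM2l T1) mulr1 (le_trans Tw)// /T; lra.
have wc : w * c <= e / 2.
  rewrite -(ler_pM2l T1) mulrA; apply: (@le_trans _ _ (L * c)).
    by rewrite ler_wpM2r.
  suff : 2 * L * c / e * e <= T * e by rewrite divfK ?gt_eqF//; lra.
  by rewrite ler_pM2r// /T; lra.
have zp : u z - e / 2 < u p.
  apply: zdl => //; rewrite -ball_normE /= (le_lt_trans (norm_le_enorm _))//.
have /subdiffP/(_ y Xy) := psub.
have := dotv_le_enorm (- (T *: (z - p))) (y - p); rewrite enormN dotvNl => h1.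
have h2 := uL _ _ Xp psub.
have : enorm (y - p) <= S + w.
  have -> : y - p = (y - z) + (z - p) by rewrite addrA subrK.
  exact: enormD.
have := enorm_ge0 (y - p); move: (enorm (y - p)) h1 => N h1 N0 NSw h3.
have h4 : enorm (T *: (z - p)) * N <= L * (S + w).
  by apply: ler_pM => //; exact: enorm_ge0.
have h5 : m / 2 * N ^+ 2 <= m / 2 * (S + w) ^+ 2.
  apply: ler_wpM2l; first lra.
  by rewrite ler_pXn2r ?nnegrE// addr_ge0.
have h6 : m / 2 * w ^+ 2 <= m / 2 * w.
  apply: ler_wpM2l; first lra.
  by rewrite expr2 ler_piMr.
have h7 : 0 <= m * w by rewrite mulr_ge0.
rewrite /c in wc; rewrite sqrrD in h5; lra.
Qed.

Lemma minval_argmin X u z : argmin_on X u z -> minval X u = u z.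
Proof.
move=> [Xz zmin]; apply/eqP; rewrite eq_le; apply/andP; split.
  apply: ge_inf; last by exists z.
  by exists (u z) => _ [y Xy <-]; exact: zmin.
apply: lb_le_inf; first by exists (u z), z.
by move=> _ [y Xy <-]; exact: zmin.
Qed.

Lemma minval_ge X u x b : X x -> (forall y, X y -> b <= u y) ->
  b <= minval X u <= u x.
Proof.
move=> Xx ub; apply/andP; split.
  by apply: lb_le_inf; [exists (u x), x|move=> _ [y Xy <-]; exact: ub].
apply: ge_inf; last by exists x.
by exists b => _ [y Xy <-]; exact: ub.
Qed.

Definition prox_obj l u x : 'rV[R]_d -> R :=
  fun y => u y + (2 * l)^-1 * enorm (y - x) ^+ 2.

(** The upper bound tests the infimum at [x + h] with the old minimizer [z]. The lower bound uses
    the growth of the objective at [x] and completes a square in [y - z], so no minimizer at [x + h]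
    is involved. *)
Lemma moreau_env_expansion X m l u x z h : 0 < m -> 0 < l ->
  strongly_convex X m (prox_obj l u x) -> argmin_on X (prox_obj l u x) z ->
  `|moreau_env X l u (x + h) - moreau_env X l u x - l^-1 * dotv (x - z) h|
    <= ((2 * l)^-1 + (2 * m)^-1 * l^-1 ^+ 2) * enorm h ^+ 2.
Proof.
move=> m0 l0 ucvx zmin; have Xz := zmin.1.
have -> : moreau_env X l u x = prox_obj l u x z by exact: minval_argmin.
have lb y : X y -> prox_obj l u x z + l^-1 * dotv (x - z) h
    - (2 * m)^-1 * l^-1 ^+ 2 * enorm h ^+ 2 <= prox_obj l u (x + h) y.
  move=> Xy; have := strongly_convex_growth ucvx zmin Xy.
  have : 0 <= m / 2 * enorm (y - z - (m^-1 * l^-1) *: h) ^+ 2.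
    by rewrite mulr_ge0 ?sqr_ge0//; lra.
  have : 0 <= (2 * l)^-1 * enorm h ^+ 2.
    by rewrite mulr_ge0 ?sqr_ge0// invr_ge0; lra.
  rewrite /prox_obj.
  have -> : y - (x + h) = (y - z) + (z - x) - h by rewrite addrA subrK opprD addrA.
  have -> : y - x = (y - z) + (z - x) by rewrite addrA subrK.
  rewrite -(opprB z x); move: (y - z) (z - x) => W V.
  have -> : m / 2 * enorm (W - (m^-1 * l^-1) *: h) ^+ 2
    = m / 2 * dotv W W - l^-1 * dotv W h + m^-1 / 2 * l^-1 ^+ 2 * dotv h h.
    by rewrite sqr_enorm !dotvE (dotvC h W); field; rewrite !gt_eqF.
  rewrite !sqr_enorm !dotvE !invfM (dotvC V W) (dotvC h W) (dotvC h V).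
  lra.
have /andP[lbenv ubenv] := minval_ge Xz lb.
rewrite ler_norml; apply/andP; split.
  suff : 0 <= (2 * l)^-1 * enorm h ^+ 2 by rewrite /moreau_env -/(prox_obj l u (x + h)); lra.
  by rewrite mulr_ge0 ?sqr_ge0// invr_ge0; lra.
have : 0 <= (2 * m)^-1 * l^-1 ^+ 2 * enorm h ^+ 2.
  by rewrite mulr_ge0 ?sqr_ge0// mulr_ge0 ?sqr_ge0// invr_ge0; lra.
move: ubenv; rewrite /moreau_env -/(prox_obj l u (x + h)) /prox_obj.
have -> : z - (x + h) = (z - x) - h by rewrite opprD addrA.
rewrite -(opprB z x) !sqr_enorm !dotvE !invfM (dotvC h z) (dotvC h x).
lra.
Qed.

Lemma gradient_moreau_env X m l u x z : 0 < m -> 0 < l ->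
  strongly_convex X m (prox_obj l u x) -> argmin_on X (prox_obj l u x) z ->
  gradient (moreau_env X l u) x = l^-1 *: (x - z).
Proof.
move=> m0 l0 ucvx zmin; apply/rowP => i; rewrite !mxE /derive.
set C := (2 * l)^-1 + (2 * m)^-1 * l^-1 ^+ 2.
have C0 : 0 < C by rewrite addr_gt0// ?mulr_gt0 ?exprn_gt0// ?invr_gt0//; lra.
pose e : 'rV[R]_d := delta_mx 0 i.
have dote v : dotv v e = v 0 i.
  rewrite /dotv (bigD1 i)//= mxE !eqxx mulr1 big1 ?addr0// => j ji.
  by rewrite mxE (negbTE ji) andbF mulr0.
apply/cvg_lim => //; apply/cvgrPdist_le => eps eps0.
near=> t.
have t0 : t != 0 by near: t; exact: nbhs_dnbhs_neq.
have tC : `|t| <= eps / C.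
  near: t; apply: dnbhs0_le; exact: divr_gt0.
have := moreau_env_expansion (t *: e) m0 l0 ucvx zmin.
rewrite sqr_enorm !dotvZr dotvZl !dote !mxE !eqxx /= -/C => h.
rewrite distrC /= -(ler_pM2l (_ : 0 < `|t|)) ?normr_gt0// -normrM.
have -> : t * (t^-1 *: (moreau_env X l u (t *: e + x) - moreau_env X l u x)
    - l^-1 * (x 0 i - z 0 i)) =
    moreau_env X l u (x + t *: e) - moreau_env X l u x - l^-1 * (t * (x 0 i - z 0 i)).
  by rewrite (addrC x) /GRing.scale /=; field; rewrite t0 gt_eqF.
apply: le_trans h _; rewrite mulr1 -expr2 -real_normK ?num_real// expr2 mulrCA.
by rewrite ler_wpM2l// mulrC -ler_pdivlMr.
Unshelve. all: by end_near. Qed.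

End prox.

(** * One step of the method: contraction towards the proximal point [xh] *)

Section prox_subgrad_step.
Context {R : realType} {d : nat}.
Context (X : set 'rV[R]_d) (f r : 'rV[R]_d -> R) (rho eta lambda a : R).
Context (x xp xh g : 'rV[R]_d).
Context (X_convex : convex_set X) (rho_ge0 : 0 <= rho) (eta_ge0 : 0 <= eta).
Context (f_wc : weakly_convex X rho f) (r_wc : weakly_convex X eta r).
Context (lambda_gt0 : 0 < lambda).
Let D := lambda^-1 - rho - 2 * eta.
Context (D_gt0 : 0 < D).
Context (a_gt0 : 0 < a) (Xx : X x) (g_sub : subdiff X rho f x g).
Context (xp_argmin : argmin_on X
  (fun y => dotv g y + r y + (2 * a)^-1 * enorm (y - x) ^+ 2) xp).
Context (xh_argmin : argmin_on X (prox_obj lambda (f \+ r) x) xh).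

Lemma prox_obj_strongly_convex z :
  strongly_convex X (lambda^-1 - rho - eta) (prox_obj lambda (f \+ r) z).
Proof.
have -> : lambda^-1 - rho - eta = (- rho + - eta) + 2 * (2 * lambda)^-1.
  by field; rewrite gt_eqF.
apply: strongly_convexD; last exact: strongly_convex_quad.
by apply: strongly_convexD; exact: weakly_strongly_convex.
Qed.

Let P := enorm (xh - x) ^+ 2.
Let Q := enorm (xh - xp) ^+ 2.
Let s := enorm (xp - x).

Lemma prox_growth y : X y ->
  f xh + r xh + lambda^-1 / 2 * P
    + (lambda^-1 - rho - eta) / 2 * enorm (xh - y) ^+ 2
  <= f y + r y + lambda^-1 / 2 * enorm (y - x) ^+ 2.
Proof.
move=> Xy.
have := strongly_convex_growth (@prox_obj_strongly_convex x) xh_argmin Xy.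
by rewrite /prox_obj /= invfM (enormB y xh) (mulrC _ lambda^-1).
Qed.

Lemma prox_growth_center :
  f xh + r xh + (lambda^-1 - (rho + eta) / 2) * P <= f x + r x.
Proof.
have := prox_growth Xx.
by rewrite -/P subrr -(scale0r (0 : 'rV[R]_d)) sqr_enorm dotvZl mul0r; lra.
Qed.

(** Add the subgradient inequalities of [r] at [xp] and of [f] at [x], both tested at [xh]; the
    inner product of [xp - x] and [xh - xp] equals [(P - Q - s ^+ 2) / 2]. *)
Lemma prox_step_three_point : (1 - a * eta) * Q <=
  2 * a * (f xh + r xh - f x - r xp) + (1 + a * rho) * P
  + 2 * a * dotv g (x - xp) - s ^+ 2.
Proof.
have Xh := xh_argmin.1.
have := prox_step_subdiff X_convex r_wc a_gt0 xp_argmin.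
move=> /subdiffP/(_ _ Xh) r_xp.
have /subdiffP/(_ _ Xh) f_x := g_sub.
have r_xp' := ler_wpM2l (ltW a_gt0) r_xp.
have f_x' := ler_wpM2l (ltW a_gt0) f_x.
have aV : a * a^-1 = 1 by rewrite divff// gt_eqF.
have e1 : a * dotv (- (g + a^-1 *: (xp - x))) (xh - xp) =
  - (a * dotv g (xh - xp)) - dotv (xp - x) (xh - xp).
  by rewrite dotvNl dotvDl dotvZl mulrN mulrDr mulrA aV mul1r opprD.
rewrite !(mulrBr a) !(mulrDr a) e1 in r_xp' f_x'.
move: r_xp' f_x'; rewrite /P /Q /s !sqr_enorm !dotvE.
rewrite (dotvC x xp) (dotvC xh x) (dotvC xh xp); lra.
Qed.


Lemma moreau_env_descent b E : (forall y, X y -> b <= (f \+ r) y) ->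
  Q <= (1 - a * D) * P + E ->
  moreau_env X lambda (f \+ r) xp - moreau_env X lambda (f \+ r) x <=
  - ((1 - lambda * (rho + 2 * eta)) * a / 2
     * enorm (gradient (moreau_env X lambda (f \+ r)) x) ^+ 2)
  + (2 * lambda)^-1 * E.
Proof.
move=> lb QPE; have l20 : 0 < (2 * lambda)^-1 by rewrite invr_gt0 mulr_gt0.
have m0 : 0 < lambda^-1 - rho - eta by move: D_gt0 eta_ge0; rewrite /D; lra.
rewrite (gradient_moreau_env m0 lambda_gt0 (@prox_obj_strongly_convex x) xh_argmin).
rewrite enormZ ?invr_ge0 ?(ltW lambda_gt0)// exprMn enormB -/P.
have -> : moreau_env X lambda (f \+ r) x = prox_obj lambda (f \+ r) x xh.
  exact: minval_argmin.
have /andP[_] : b <= moreau_env X lambda (f \+ r) xp <= prox_obj lambda (f \+ r) xp xh.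
  apply: minval_ge; first exact: xh_argmin.1.
  move=> y Xy; apply: (le_trans (lb _ Xy)).
  by rewrite lerDl mulr_ge0 ?sqr_ge0// ltW.
(* [1 - lambda * (rho + 2 * eta)] is [lambda * D], so the gradient term is exactly the gain of the
   contraction. *)
have -> : (1 - lambda * (rho + 2 * eta)) * a / 2 * (lambda^-1 ^+ 2 * P)
  = (2 * lambda)^-1 * (a * D * P).
  by rewrite /D; field; rewrite gt_eqF.
rewrite /prox_obj -/P -/Q.
have := ler_wpM2l (ltW l20) QPE; lra.
Qed.

(** The proximal growth is used at [xp], which cancels [r xp]; the remaining [f xp - f x] is bounded
    by the subgradient [gp] at [xp]. *)
Lemma contraction_bounded_f gp L : subdiff X rho f xp gp ->
  enorm g <= L -> enorm gp <= L ->
  a * (2 * (lambda^-1 + 2 * eta + rho)) <= 1 ->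
  Q <= (1 - a * D) * P + 8 * L ^+ 2 * a ^+ 2.
Proof.
move=> /subdiffP/(_ x Xx) f_xp gL gpL a_le.
have Xp := xp_argmin.1.
have step := prox_step_three_point.
have growth := ler_wpM2l (ltW a_gt0) (prox_growth Xp).
have f_xp' := ler_wpM2l (ltW a_gt0) f_xp.
have s0 : 0 <= s by exact: enorm_ge0.
have P0 : 0 <= P by exact: sqr_ge0.
have Q0 : 0 <= Q by exact: sqr_ge0.
have gs : a * dotv g (x - xp) <= a * (L * s).
  rewrite ler_wpM2l ?(ltW a_gt0)// (le_trans (dotv_le_enorm _ _))//.
  by rewrite enormB ler_wpM2r.
have gps : a * - dotv gp (x - xp) <= a * (L * s).
  rewrite ler_wpM2l ?(ltW a_gt0)// -dotvNl (le_trans (dotv_le_enorm _ _))//.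
  by rewrite enormN enormB ler_wpM2r.
rewrite -/Q -/s enormB -/s in growth f_xp'.
have aD : 0 <= a * D by rewrite mulr_ge0 ?(ltW a_gt0)// ltW.
have aDQ : 0 <= a * D * Q by rewrite mulr_ge0.
have al0 : 0 <= a * lambda^-1 by rewrite mulr_ge0 ?invr_ge0 ?(ltW a_gt0) ?(ltW lambda_gt0)//.
have ae0 : 0 <= a * eta by rewrite mulr_ge0 ?(ltW a_gt0)//.
have aeP : 0 <= a * eta * P by rewrite mulr_ge0.
have ar0 : 0 <= a * rho by rewrite mulr_ge0 ?(ltW a_gt0)//.
(* The stepsize bound preserves [s ^+ 2 / 2], which absorbs [4 * a * L * s] up to
   [8 * L ^+ 2 * a ^+ 2]. *)
have half : 0 <= (1 / 2 - a * lambda^-1 - a * rho) * s ^+ 2.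
  rewrite mulr_ge0 ?sqr_ge0//; lra.
have sq : 0 <= (s - 4 * L * a) ^+ 2 by exact: sqr_ge0.
rewrite /D in aDQ *; lra.
Qed.

Lemma contraction_bounded_r L : bounded_subgrad X eta r L ->
  (forall y z, X y -> X z ->
     r z <= r y + L * enorm (y - z) + eta / 2 * enorm (y - z) ^+ 2) ->
  Q <= (1 - a * D) * P + (5 + 8 * eta / D) * (a * (enorm g + L)) ^+ 2.
Proof.
have [Xp Xh] := (xp_argmin.1, xh_argmin.1).
move=> rL rlip; set b := a * (enorm g + L).
pose v := - (g + a^-1 *: (xp - x)).
have v_sub : subdiff X eta r xp v by exact: (prox_step_subdiff X_convex r_wc a_gt0).
have vL : enorm v <= L by exact: rL v_sub.
have L0 : 0 <= L by exact: le_trans (enorm_ge0 v) vL.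
have stepE : xp - x = - (a *: (g + v)).
  by rewrite /v opprD addNKr scalerN opprK scalerA divff ?gt_eqF// scale1r.
have s0 : 0 <= s by exact: enorm_ge0.
have P0 : 0 <= P by exact: sqr_ge0.
have b0 : 0 <= b by rewrite mulr_ge0 ?(ltW a_gt0)// addr_ge0 ?enorm_ge0.
have center := ler_wpM2l (ltW a_gt0) prox_growth_center.
have aD : 0 <= a * D by rewrite mulr_ge0 ?(ltW a_gt0)// ltW.
have ae0 : 0 <= a * eta by rewrite mulr_ge0 ?(ltW a_gt0)//.
have aDP : 0 <= a * D * P by rewrite mulr_ge0.
have aeP : 0 <= a * eta * P by rewrite mulr_ge0.
have aeaDP : 0 <= a * eta * (a * D * P) by rewrite mulr_ge0.
have eDb0 : 0 <= 8 * eta / D * b ^+ 2.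
  by rewrite mulr_ge0 ?sqr_ge0// divr_ge0 ?(ltW D_gt0)// mulr_ge0.
have b20 : 0 <= b ^+ 2 by exact: sqr_ge0.
(* Below 1/2, dividing the three-point inequality by [1 - a * eta] costs at most a factor 2, and the
   constant 5 suffices. Above it, that factor may be nonpositive; the term in [eta / D] serves this
   regime. *)
have [ae_lt|ae_ge] := ltP (a * eta) (1 / 2).
  have step := prox_step_three_point.
  have r_x := ler_wpM2l (ltW a_gt0) (rlip xp x Xp Xx).
  have gs : a * dotv g (x - xp) <= a * (enorm g * s).
    by rewrite ler_wpM2l ?(ltW a_gt0)// /s enormB dotv_le_enorm.
  rewrite -/s in r_x.
  have ks : 0 <= (1 / 2 - a * eta) * s ^+ 2 by rewrite mulr_ge0 ?sqr_ge0//; lra.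
  have kb : 0 <= (1 / 2 - a * eta) * b ^+ 2 by rewrite mulr_ge0 ?sqr_ge0//; lra.
  have keb : 0 <= (1 - a * eta) * (8 * eta / D * b ^+ 2) by rewrite mulr_ge0//; lra.
  have sq : 0 <= (s - 2 * b) ^+ 2 by exact: sqr_ge0.
  have bs : b * s = a * (enorm g * s) + a * (L * s) by rewrite /b; ring.
  rewrite -(ler_pM2l (_ : 0 < 1 - a * eta)); last by lra.
  rewrite /D in aDP aeaDP keb *; lra.
have sb : s <= b.
  rewrite /s stepE enormN enormZ ?(ltW a_gt0)// ler_pM2l//.
  by rewrite (le_trans (enormD _ _))// lerD2l.
have sb2 : s ^+ 2 <= b ^+ 2 by rewrite ler_pXn2r ?nnegrE.
(* The step is [- a (g + v)], so [Q] expands exactly; the proximal growth at [x] bounds the [g]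
   term. *)
have QE : Q = P + 2 * (a * dotv g (xh - x)) + 2 * (a * dotv v (xh - x)) + s ^+ 2.
  have -> : Q = enorm ((xh - x) - (xp - x)) ^+ 2 by rewrite opprB addrA subrK.
  rewrite sqr_enormD enormN -/P -/s stepE opprK dotvZr dotvDr !(dotvC (xh - x)).
  by ring.
have /subdiffP/(_ _ Xh)/(ler_wpM2l (ltW a_gt0)) f_x := g_sub.
have r_x := ler_wpM2l (ltW a_gt0) (rlip xh x Xh Xx).
pose p := enorm (xh - x).
have pP : P = p ^+ 2 by [].
have vp : a * dotv v (xh - x) <= a * (L * p).
  rewrite ler_wpM2l ?(ltW a_gt0)// (le_trans (dotv_le_enorm _ _))//.
  by rewrite ler_wpM2r ?enorm_ge0.
rewrite -/p -pP in r_x f_x.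
have aLb : a * L <= b by rewrite ler_wpM2l ?(ltW a_gt0)// lerDr enorm_ge0.
(* AM-GM: [4 a L p <= a D p^2 + 4 a L^2 / D], and [1 <= 2 a eta] turns the
   last term into a multiple of [(a L)^2]. *)
have amgm : 4 * (a * (L * p)) <= a * D * P + 8 * eta / D * b ^+ 2.
  have : 0 <= a / D * (D * p - 2 * L) ^+ 2.
    by rewrite mulr_ge0 ?sqr_ge0// divr_ge0 ?(ltW a_gt0) ?(ltW D_gt0).
  have -> : a / D * (D * p - 2 * L) ^+ 2
    = a * D * p ^+ 2 - 4 * (a * (L * p)) + 4 * (a * L ^+ 2 / D).
    by field; rewrite gt_eqF.
  suff : a * L ^+ 2 / D <= 2 * eta / D * b ^+ 2 by rewrite pP; lra.
  rewrite [leRHS]mulrAC ler_pM2r ?invr_gt0//.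
  have aLb2 : (a * L) ^+ 2 <= b ^+ 2.
    by rewrite ler_pXn2r ?nnegrE// mulr_ge0 ?(ltW a_gt0).
  apply: (@le_trans _ _ (2 * eta * (a * L) ^+ 2)); last first.
    by rewrite ler_wpM2l// mulr_ge0.
  have : 0 <= a * L ^+ 2 by rewrite mulr_ge0 ?sqr_ge0 ?(ltW a_gt0).
  move=> aL2; have : 0 <= (2 * (a * eta) - 1) * (a * L ^+ 2) by rewrite mulr_ge0//; lra.
  lra.
rewrite QE.
rewrite /D in aDP amgm *; lra.
Qed.

(** The proximal growth is used at [x], which cancels [f x]; bounding [r x - r xp] by [h] joins [g]
    and [h] into the single term in [g + h]. *)
Lemma contraction_bounded_sum h G : subdiff X eta r x h ->
  enorm (g + h) <= G -> a * (6 * eta) <= 1 ->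
  Q <= (1 - a * D) * P + 2 * a ^+ 2 * G ^+ 2.
Proof.
have Xp := xp_argmin.1.
move=> /subdiffP/(_ xp Xp) r_x ghG a_le.
have step := prox_step_three_point.
have center := ler_wpM2l (ltW a_gt0) prox_growth_center.
have r_x' := ler_wpM2l (ltW a_gt0) r_x.
have s0 : 0 <= s by exact: enorm_ge0.
have P0 : 0 <= P by exact: sqr_ge0.
have ghs : a * dotv (g + h) (x - xp) <= a * (G * s).
  rewrite ler_wpM2l ?(ltW a_gt0)// (le_trans (dotv_le_enorm _ _))//.
  by rewrite enormB ler_wpM2r.
rewrite -/s -(opprB x xp) dotvNr in r_x'.
rewrite dotvDl in ghs.
have aD : 0 <= a * D by rewrite mulr_ge0 ?(ltW a_gt0)// ltW.
have ae0 : 0 <= a * eta by rewrite mulr_ge0 ?(ltW a_gt0)//.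
have aDP : 0 <= a * D * P by rewrite mulr_ge0.
have aeP : 0 <= a * eta * P by rewrite mulr_ge0.
have aeaDP : 0 <= a * eta * (a * D * P) by rewrite mulr_ge0.
have k0 : 5 / 6 <= 1 - a * eta by lra.
have ks : 0 <= (1 / 6 - a * eta) * s ^+ 2 by rewrite mulr_ge0 ?sqr_ge0//; lra.
have kG : 0 <= (1 / 6 - a * eta) * (a * G) ^+ 2 by rewrite mulr_ge0 ?sqr_ge0//; lra.
(* Since [1 - a * eta >= 5 / 6], this square absorbs [2 * a * G * s] into [5 / 6 * s ^+ 2] up to
   [6 / 5 * (a * G) ^+ 2]. *)
have sq : 0 <= (5 * s - 6 * (a * G)) ^+ 2 by exact: sqr_ge0.
rewrite -(ler_pM2l (_ : 0 < 1 - a * eta)); last by lra.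
have aG0 : 0 <= (a * G) ^+ 2 by exact: sqr_ge0.
rewrite /D in aDP aeaDP *; lra.
Qed.

End prox_subgrad_step.

(** * The recursion under each of the three conditions *)

Theorem lemma4p3 (R : realType) (d : nat) (X : set 'rV[R]_d)
    (f r : 'rV[R]_d -> R) (rho eta lambda : R)
    (alpha beta : nat -> R) (g x : nat -> 'rV[R]_d)
    (X_closed : closed X) (X_convex : convex_set X)
    (f_lsc : lsc_on X f) (r_lsc : lsc_on X r)
    (argmin_neq0 : argmin_on X (f \+ r) !=set0)
    (rho_ge0 : 0 <= rho) (eta_ge0 : 0 <= eta)
    (f_wc : weakly_convex X rho f) (r_wc : weakly_convex X eta r)
    (lambda_gt0 : 0 < lambda)
    (lambda_lt : (lambda%:E < ((rho + 2 * eta)%:E)^-1)%E)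
    (x_gen : prox_subgrad X rho f r alpha g x)
    (beta_sigma : sigma_sequence beta)
    (cases :
      [\/ exists2 Lf : R, bounded_subgrad X rho f Lf &
            forall k, alpha k = beta k /\
              beta k < (2 * (lambda^-1 + 2 * eta + rho))^-1,
          exists2 Lr : R, bounded_subgrad X eta r Lr &
            forall k, alpha k = beta k / (enorm (g k) + Lr)
        | exists c3 c4 : R,
            [/\ 0 <= c3, 0 <= c4,
                env_bounded_subgrad X rho eta lambda f r c3 c4 &
                forall k, alpha k = beta k /\
                  ((beta k)%:E < ((6 * eta)%:E)^-1)%E]]) :
  let env := moreau_env X lambda (f \+ r) in
  let min_phi := minval X (f \+ r) in
  exists gamma1 gamma2 : R,
    [/\ 0 <= gamma1, 0 <= gamma2 &
      forall k : nat,
        (env (x k.+1) - min_phi)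
          - (1 + gamma1 * beta k ^+ 2) * (env (x k) - min_phi)
        <= - ((1 - lambda * (rho + 2 * eta)) * alpha k / 2
              * enorm (gradient env (x k)) ^+ 2)
           + gamma2 * beta k ^+ 2].
Proof.
move=> env min_phi.
have D_gt0 : 0 < lambda^-1 - rho - 2 * eta.
  rewrite -addrA -opprD subr_gt0.
  have re0 : 0 <= rho + 2 * eta by rewrite addr_ge0// mulr_ge0.
  (* The extended inverse of 0 is [+oo]; in that case the claim reduces to [0 < lambda^-1]. *)
  move: lambda_lt; rewrite inver; case: ifPn => [/eqP ->|re_neq0].
    by rewrite invr_gt0.
  have re_gt0 : 0 < rho + 2 * eta by rewrite lt_neqAle eq_sym re_neq0.
  by rewrite lte_fin => lt; rewrite -[ltLHS]invrK ltf_pV2// posrE invr_gt0.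
have [x0_in steps] := x_gen.
have x_in k : X (x k) by case: k => // k; have [_ _ []] := steps k.
have a_gt0 k : 0 < alpha k by have [] := steps k.
have g_sub k : subdiff X rho f (x k) (g k) by have [] := steps k.
have x_next k := let: And3 _ _ h := steps k in h.
have [beta_gt0 _ _] := beta_sigma.
have [xs xs_min] := argmin_neq0.
have min_le y : X y -> min_phi <= (f \+ r) y.
  by move=> Xy; rewrite /min_phi (minval_argmin xs_min); exact: xs_min.2.
have l20 : 0 < (2 * lambda)^-1 by rewrite invr_gt0 mulr_gt0.
have prox_ex k : argmin_on X (prox_obj lambda (f \+ r) (x k)) !=set0.
  apply: (@coercive_argmin _ _ X _ (x k) (x k) min_phi 0 (2 * lambda)^-1) => //.
    exact/lsc_on_add_quad/lsc_onD.
  by move=> y Xy; rewrite /prox_obj mul0r subr0 lerD2r; exact: min_le.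
have env_ge k : min_phi <= env (x k).
  have [xh xh_min] := prox_ex k.
  rewrite /env /moreau_env -/(prox_obj lambda (f \+ r) (x k)) (minval_argmin xh_min).
  by rewrite (le_trans (min_le _ xh_min.1))// lerDl mulr_ge0 ?sqr_ge0// ltW.
have descent k E : (forall xh, argmin_on X (prox_obj lambda (f \+ r) (x k)) xh ->
    enorm (xh - x k.+1) ^+ 2 <=
    (1 - alpha k * (lambda^-1 - rho - 2 * eta)) * enorm (xh - x k) ^+ 2 + E) ->
  env (x k.+1) - env (x k) <=
  - ((1 - lambda * (rho + 2 * eta)) * alpha k / 2
     * enorm (gradient env (x k)) ^+ 2) + (2 * lambda)^-1 * E.
  have [xh xh_min] := prox_ex k => /(_ _ xh_min).
  exact: (moreau_env_descent X_convex eta_ge0 f_wc r_wc lambda_gt0 D_gt0 xh_min min_le).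
case: cases => [[Lf fL alpha_eq]|[Lr rL alpha_eq]|[c3 [c4 [c30 c40 phiL alpha_eq]]]].
- exists 0, ((2 * lambda)^-1 * (8 * Lf ^+ 2)); split=> //.
    by rewrite mulr_ge0 ?(ltW l20)// mulr_ge0// sqr_ge0.
  move=> k; have [ab b_lt] := alpha_eq k.
  have a_le : alpha k * (2 * (lambda^-1 + 2 * eta + rho)) <= 1.
    have c_gt0 : 0 < 2 * (lambda^-1 + 2 * eta + rho).
      have : 0 < lambda^-1 by rewrite invr_gt0.
      have := rho_ge0; have := eta_ge0; lra.
    by rewrite -ler_pdivlMr// mul1r ab ltW.
  suff : env (x k.+1) - env (x k) <=
      - ((1 - lambda * (rho + 2 * eta)) * alpha k / 2
         * enorm (gradient env (x k)) ^+ 2)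
      + (2 * lambda)^-1 * (8 * Lf ^+ 2 * alpha k ^+ 2) by rewrite -ab; lra.
  apply: descent => xh xh_min.
  exact: (contraction_bounded_f X_convex rho_ge0 eta_ge0 f_wc r_wc lambda_gt0 D_gt0
    (a_gt0 k) (x_in k) (g_sub k) (x_next k) xh_min (g_sub k.+1)
    (fL _ _ (x_in k) (g_sub k)) (fL _ _ (x_in k.+1) (g_sub k.+1)) a_le).
(* The weak Lipschitz bound requires one subgradient of [r]; optimality of the first step provides
   it at [x 1]. *)
- have v_sub := prox_step_subdiff X_convex r_wc (a_gt0 0%N) (x_next 0%N).
  have r_lip := bounded_subgrad_weak_lipschitz X_closed X_convex r_lsc eta_ge0 r_wc
    (x_in 1%N) v_sub rL.
  pose C := 5 + 8 * eta / (lambda^-1 - rho - 2 * eta).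
  exists 0, ((2 * lambda)^-1 * C); split=> //.
    rewrite mulr_ge0 ?(ltW l20)// addr_ge0// divr_ge0 ?(ltW D_gt0)//.
    by rewrite mulr_ge0.
  move=> k.
  have ab : alpha k * (enorm (g k) + Lr) = beta k.
    (* A zero denominator would give [alpha k = 0], as the inverse of 0 is 0, against positivity of
       the stepsize. *)
    rewrite alpha_eq divfK//; apply: contraTneq (a_gt0 k) => gL0.
    by rewrite alpha_eq gL0 invr0 mulr0 ltxx.
  suff : env (x k.+1) - env (x k) <=
      - ((1 - lambda * (rho + 2 * eta)) * alpha k / 2
         * enorm (gradient env (x k)) ^+ 2)
      + (2 * lambda)^-1 * (C * beta k ^+ 2) by lra.
  apply: descent => xh xh_min; rewrite -ab.
  exact: (contraction_bounded_r X_convex eta_ge0 f_wc r_wc lambda_gt0 D_gt0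
    (a_gt0 k) (x_in k) (g_sub k) (x_next k) xh_min rL r_lip).
- have l0 : 0 <= lambda^-1 by rewrite invr_ge0 ltW.
  (* The recursion with [gamma1 = lambda^-1 * c3] says that [gap k] is at most
     [gamma2 * beta k ^+ 2]. *)
  pose gap k := (env (x k.+1) - min_phi)
    - (1 + lambda^-1 * c3 * beta k ^+ 2) * (env (x k) - min_phi)
    + (1 - lambda * (rho + 2 * eta)) * alpha k / 2
              * enorm (gradient env (x k)) ^+ 2.
  have gapS k : gap k.+1 <= lambda^-1 * c4 * beta k.+1 ^+ 2.
    have [ab b_lt] := alpha_eq k.+1.
    have a_le : alpha k.+1 * (6 * eta) <= 1.
      move: b_lt; rewrite inver; case: ifPn => [/eqP -> _|e_neq0].
        by rewrite mulr0.
      have e_gt0 : 0 < 6 * eta by rewrite lt_neqAle eq_sym e_neq0 mulr_ge0.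
      by rewrite lte_fin ab -ler_pdivlMr// mul1r => /ltW.
    (* The subgradient of [r] at the current iterate comes from the optimality of the previous step,
       hence the index [k.+1]. *)
    have h_sub := prox_step_subdiff X_convex r_wc (a_gt0 k) (x_next k).
    have ghL := phiL _ _ _ (x_in k.+1) (g_sub k.+1) h_sub.
    have G0 : 0 <= c3 * (env (x k.+1) - min_phi) + c4.
      by rewrite addr_ge0// mulr_ge0// subr_ge0.
    suff : env (x k.+2) - env (x k.+1) <=
        - ((1 - lambda * (rho + 2 * eta)) * alpha k.+1 / 2
           * enorm (gradient env (x k.+1)) ^+ 2)
        + (2 * lambda)^-1 * (2 * alpha k.+1 ^+ 2 *
            (c3 * (env (x k.+1) - min_phi) + c4)).
      by rewrite /gap ab invfM; lra.
    apply: descent => xh xh_min; rewrite -(sqr_sqrtr G0).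
    exact: (contraction_bounded_sum X_convex eta_ge0 f_wc r_wc lambda_gt0 D_gt0
      (a_gt0 k.+1) (x_in k.+1) (g_sub k.+1) (x_next k.+1) xh_min h_sub ghL a_le).
  (* [r] may have no subgradient at the starting point [x 0], where the third
     condition is then void: the first step is absorbed in [gamma2]. *)
  exists (lambda^-1 * c3), (lambda^-1 * c4 + `|gap 0%N| / beta 0%N ^+ 2).
  have b2 k : 0 < beta k ^+ 2 by rewrite exprn_gt0.
  have g0 : 0 <= `|gap 0%N| / beta 0%N ^+ 2 by rewrite divr_ge0// ltW.
  have l4 : 0 <= lambda^-1 * c4 by rewrite mulr_ge0.
  split; [by rewrite mulr_ge0|by rewrite addr_ge0|].
  suff gap_le k : gap k <= (lambda^-1 * c4 + `|gap 0%N| / beta 0%N ^+ 2) * beta k ^+ 2.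
    by move=> k; have := gap_le k; rewrite /gap; lra.
  rewrite mulrDl; case: k => [|k].
    rewrite divfK ?gt_eqF// (le_trans (ler_norm _))// lerDr.
    by rewrite mulr_ge0// ltW.
  by rewrite (le_trans (gapS k))// lerDl mulr_ge0// ltW.
Qed.
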